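(* Let $\omega\in\mathbb{R}$, $T>0$, and let $u=u(t,x)$ be a solution, defined on $[0,T)\times\mathbb{R}$, of the DGH equation with $\gamma=-2\omega$, i.e. of $$u_t+(u+2\omega)u_x=-\partial_x\Lambda^{-2}\left(u^2+\frac{u_x^2}{2}\right),$$ whose sign does not change (that is, either $u\ge 0$ everywhere or $u\le 0$ everywhere). Assume that: (i) the quantity $\int_{\mathbb{R}}u(t,x)\,dx$ is conserved (independent of $t\in[0,T)$); (ii) for each fixed $t$, $\partial_x\Lambda^{-2}\left(u^2+u_x^2/2\right)(t,\cdot)\in C^1(\mathbb{R})$; (iii) there exist numbers $t_0,t_1,x_0,x_1$ with $0<t_0<t_1<T$ and $x_0<x_1$ such that $u(t,x)=0$ for all $(t,x)\in(t_0,t_1)\times(x_0,x_1)$. Then $u\equiv 0$.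
   Context: $\Lambda^{2}=1-\partial_x^2$, with inverse $\Lambda^{-2}f=g\ast f$, where $g(x)=e^{-|x|}/2$ on $\mathbb{R}$. The DGH (Dullin-Gottwald-Holm) equation is $u_t-u_{txx}+2\omega u_x+3uu_x+\gamma u_{xxx}=2u_xu_{xx}+uu_{xxx}$; for $\gamma=-2\omega$ it is rewritten in the non-local form given in the claim. *)

(* Defs.v *)
From HB Require Import structures.
From mathcomp Require Import all_boot all_order all_algebra.
From mathcomp Require Import all_classical all_reals all_analysis.
Set Implicit Arguments.
Unset Strict Implicit.
Unset Printing Implicit Defensive.
Import Order.TTheory GRing.Theory Num.Theory numFieldNormedType.Exports.
Local Open Scope classical_set_scope.
Local Open Scope ring_scope.

(* Functions of (t, x) are curried, time first: [u t] is the profile at time t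
   and [u ^~ x] is the time evolution at the point x. *)

Definition green {R : realType} (x : R) : R := expR (- `|x|) / 2.

Definition convolvable {R : realType} (f g : R -> R) : Prop :=
  forall x, lebesgue_measure.-integrable [set: R]
    (fun y => (f (x - y) * g y)%:E).

(* [Rintegral] is 0 when the integral diverges, so this is the convolution
   only when [convolvable f g]. *)
Definition convolution {R : realType} (f g : R -> R) (x : R) : R :=
  (\int[lebesgue_measure]_(y in [set: R]) (f (x - y) * g y))%R.

Definition inv_Lambda2 {R : realType} (f : R -> R) : R -> R :=
  convolution green f.

Definition flux {R : realType} (v : R -> R) (x : R) : R :=
  v x ^+ 2 + derive1 v x ^+ 2 / 2.

Definition nonlocal {R : realType} (v : R -> R) : R -> R :=
  derive1 (inv_Lambda2 (flux v)).

Definition C1 {R : realType} (f : R -> R) : Prop :=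
  (forall x, derivable f x 1) /\ continuous (derive1 f).

(* Pointwise (strong) solutions on [0, T) x R.  The derivatives u_t and u_x are
   required to exist but not to be continuous, and no decay is imposed beyond
   the convergence of the convolution; in particular
   C([0,T); H^s) /\ C^1([0,T); H^(s-1)) with s > 3/2 is covered.  At t = 0,
   where u_t would be one-sided, u is only required to be continuous in time. *)
Record DGH_solution {R : realType} (omega T : R) (u : R -> R -> R) : Prop := {
  DGH_continuous_t : forall x, {within [set` `[0, T[], continuous (u ^~ x)} ;
  DGH_derivable_x : forall t x, 0 <= t < T -> derivable (u t) x 1 ;
  DGH_derivable_t : forall t x, 0 < t < T -> derivable (u ^~ x) t 1 ;
  DGH_convolvable : forall t, 0 <= t < T -> convolvable green (flux (u t)) ;
  DGH_derivable_nonlocal : forall t x, 0 <= t < T ->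
    derivable (inv_Lambda2 (flux (u t))) x 1 ;
  DGH_equation : forall t x, 0 < t < T ->
    derive1 (u ^~ x) t + (u t x + 2 * omega) * derive1 (u t) x = - nonlocal (u t) x
}.

(* The integral is [\bar R]-valued; for measurable [u t] it is finite exactly
   when [u t] is integrable. *)
Definition conserved_integral {R : realType} (T : R) (u : R -> R -> R) : Prop :=
  exists c : R, forall t, 0 <= t < T ->
    (\int[lebesgue_measure]_(x in [set: R]) (u t x)%:E)%E = c%:E.

(* Main.v *)
(* At a time s in (t0, t1), u, u_t and u_x vanish on (x0, x1), hence so does the
   nonlocal term: h = Lambda^-2 (u^2 + u_x^2 / 2) is constant there.  As the
   source of h vanishes on (x0, x1), the kernel gives the three-point relation
   h(m - d) + h(m + d) = 2 cosh(d) h(m) inside that interval, so h(m) = 0 since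
   cosh d > 1.  The convolution of the positive kernel with a nonnegative source
   vanishes at a point only if the source does, so u(s, .) = 0.  The conserved
   integral is therefore 0, and the constant sign forces u = 0 at all times. *)
Require Import Defs.
From HB Require Import structures.
From mathcomp Require Import all_boot all_order all_algebra.
From mathcomp Require Import all_classical all_reals all_analysis.
From mathcomp Require Import measurable_realfun ring lra.
Import Order.TTheory GRing.Theory Num.Theory numFieldNormedType.Exports.
Local Open Scope classical_set_scope.
Local Open Scope ring_scope.

Lemma derivable_continuous (R : realType) (v : R -> R) :
  (forall x, derivable v x 1) -> continuous v.
Proof.
by move=> dv x; apply/differentiable_continuous/derivable1_diffP.
Qed.

Lemma derive1_locally_eq0 (R : realType) (f : R -> R) (a b x : R) :
  a < x < b -> (forall y, a < y < b -> f y = 0) -> derive1 f x = 0.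
Proof.
move=> abx f0; rewrite derive1E (@near_eq_derive _ _ _ _ (cst 0)).
  exact: derive_cst.
have xab : x \in `]a, b[ by rewrite in_itv.
near=> y; apply: f0.
suff : y \in `]a, b[ by rewrite in_itv.
by near: y; exact: near_in_itvoo.
Unshelve. all: by end_near. Qed.

(** A nonzero value would persist on an open interval, of positive length, inside the null
    exceptional set [N]. *)
Lemma continuous_ae_eq0 (R : realType) (v : R -> R) : continuous v ->
  {ae lebesgue_measure, forall x, v x = 0} -> forall x, v x = 0.
Proof.
move=> cv [N [mN N0 vN]] x; apply: contrapT => /eqP vx0.
have [e /= e0 veN] : nbhs x (fun y => v y != 0).
  exact: (cv x _ (open_nbhs_nbhs (conj (@open_neq _ 0) vx0))).
have eN : [set` `]x - e, x + e[] `<=` N.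
  move=> y /=; rewrite in_itv/= => yxe; apply: vN => /= vy0.
  have : v y != 0 by apply: veN; rewrite /= ltr_norml; lra.
  by rewrite vy0 eqxx.
have : (lebesgue_measure [set` `]x - e, x + e[%R] <= lebesgue_measure N)%E.
  by apply: le_measure; rewrite ?inE.
rewrite N0 lebesgue_measure_itv/= lte_fin ifT; last by lra.
by rewrite -EFinB lee_fin; lra.
Qed.

Lemma ge0_integral_eq0_ae (R : realType) (f : R -> R) :
  measurable_fun setT f -> (forall x, 0 <= f x) ->
  (\int[lebesgue_measure]_x (f x)%:E)%E = 0%E ->
  {ae lebesgue_measure, forall x, f x = 0}.
Proof.
move=> mf f0 If0.
have /measurable_EFinP mEf := mf.
have /(ae_eq_integral_abs lebesgue_measure measurableT mEf) :
    (\int[lebesgue_measure]_x `|(f x)%:E| = 0)%E.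
  by under eq_integral do rewrite gee0_abs ?lee_fin//.
by apply: filterS => x /(_ I)[].
Qed.

Lemma continuous_integral_eq0 (R : realType) (v : R -> R) : continuous v ->
  (forall x, 0 <= v x) \/ (forall x, v x <= 0) ->
  (\int[lebesgue_measure]_x (v x)%:E)%E = 0%E -> forall x, v x = 0.
Proof.
move=> cv; wlog v0 : v cv / forall x, 0 <= v x => [wl [v0|v0] Iv0|_ Iv0].
- by apply: wl => //; left.
- have Nv0 x : 0 <= - v x by rewrite oppr_ge0.
  move=> x; apply/eqP; rewrite -oppr_eq0; apply/eqP.
  apply: (wl (fun x => - v x)) => //.
  + by move=> y; apply: cvgN; exact: cv.
  + by left.
  (* The minus sign passes through the extended-real integral because [- v] is nonnegative. *)
  + apply: oppe_inj; rewrite oppe0 -integral_ge0N => [|y _]; last first.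
      by rewrite lee_fin.
    by rewrite -[RHS]Iv0; apply: eq_integral => y _; rewrite -EFinN opprK.
- apply: continuous_ae_eq0 => //; apply: ge0_integral_eq0_ae => //.
  exact: continuous_measurable_fun.
Qed.

Lemma green_gt0 (R : realType) (x : R) : 0 < green x.
Proof. by rewrite divr_gt0// expR_gt0. Qed.

(** By evenness of [green] take [z] nonnegative; then [z - d] and [z + d] are nonnegative too, and
    on that half-line [green] is a single exponential. *)
Lemma green_shiftD (R : realType) (d z : R) : `|d| <= `|z| ->
  green (z - d) + green (z + d) = (expR d + expR (- d)) * green z.
Proof.
wlog z0 : z / 0 <= z => [wl dz|].
  have [/wl -> //|/ltW z0] := leP 0 z.
  have gN x : green (- x) = green x :> R by rewrite /green normrN.
  rewrite -[green z]gN -wl ?normrN ?oppr_ge0// addrC -[green (z + d)]gN.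
  by rewrite -[green (z - d)]gN; congr (green _ + green _); ring.
rewrite (ger0_norm z0) ler_norml => /andP[dz zd].
rewrite /green !ger0_norm; try lra.
by rewrite mulrDl !mulrA -!expRD; congr (expR _ / _ + expR _ / _); ring.
Qed.

Lemma inv_Lambda2_shiftD (R : realType) (f : R -> R) (m d : R) :
  convolvable green f -> (forall y, m - d < y < m + d -> f y = 0) ->
  0 <= d ->
  inv_Lambda2 f (m - d) + inv_Lambda2 f (m + d) =
  (expR d + expR (- d)) * inv_Lambda2 f m.
Proof.
move=> cf f0 d0.
rewrite /inv_Lambda2 /convolution -RintegralD//; [|exact: cf..].
rewrite -RintegralZl//; last exact: cf.
apply: eq_Rintegral => y _.
(* Compare the integrands: the source vanishes at distance less than [d] from [m], and elsewhere
   [green_shiftD] applies with [z = m - y]. *)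
have [yd|dy] := ltP `|m - y| `|d|.
  by rewrite f0 ?mulr0 ?addr0//; move: yd; rewrite (ger0_norm d0) ltr_norml; lra.
rewrite -mulrDl mulrA -green_shiftD//.
by congr ((green _ + green _) * _); ring.
Qed.

Lemma inv_Lambda2_eq0_ae (R : realType) (f : R -> R) (x : R) :
  convolvable green f -> (forall y, 0 <= f y) -> inv_Lambda2 f x = 0 ->
  {ae lebesgue_measure, forall y, f y = 0}.
Proof.
move=> cf f0 hx0.
have /integrableP[/measurable_EFinP mgf _] := cf x.
have gf0 y : 0 <= green (x - y) * f y by rewrite mulr_ge0// ltW// green_gt0.
have : {ae lebesgue_measure, forall y, green (x - y) * f y = 0}.
  apply: ge0_integral_eq0_ae => //.
  (* A zero real-valued integral could also hide an infinite one; integrability excludes this, so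
     the extended-real integral is itself zero. *)
  rewrite -[LHS]fineK ?[fine _]hx0//.
  exact: integrable_fin_num (cf x).
apply: (@filterS _ _ (ae_filter_ringOfSetsType lebesgue_measure)) => y /eqP; rewrite mulf_eq0 => /orP[|/eqP//].
by rewrite gt_eqF// green_gt0.
Qed.

Lemma inv_Lambda2_locally_cst_eq0 (R : realType) (f : R -> R) (a b : R) : a < b ->
  convolvable green f -> (forall x, a < x < b -> f x = 0) ->
  (forall x, a < x < b -> is_derive x 1 (inv_Lambda2 f) 0) ->
  inv_Lambda2 f ((a + b) / 2) = 0.
Proof.
move=> ab cf f0 dh; set m := (a + b) / 2.
have [d [d0 amd mdb]] : exists d, [/\ 0 < d, a < m - d & m + d < b].
  (* A quarter of the length keeps [m - d] and [m + d] strictly inside the interval. *)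
  by exists ((b - a) / 4); rewrite /m; split; lra.
have hE x y : a < x -> x < y -> y < b -> inv_Lambda2 f x = inv_Lambda2 f y.
  move=> ax xy yb; have [z||z _] := MVT (f := inv_Lambda2 f) (df := cst 0) xy.
  - by rewrite in_itv/= => ?; apply: dh; lra.
  - apply: derivable_within_continuous => z; rewrite in_itv/= => ?.
    by have [] : is_derive z 1 (inv_Lambda2 f) 0 by apply: dh; lra.
  - by rewrite mul0r => /subr0_eq.
(* Add the strict bounds [1 + x < expR x] at [x = d] and [x = - d]. *)
have cosh_gt1 : 2 < expR d + expR (- d).
  have := expR_gt1Dx (lt0r_neq0 d0).
  have := @expR_gt1Dx _ (- d); rewrite oppr_eq0 lt0r_neq0// => /(_ isT); lra.
have : inv_Lambda2 f (m - d) + inv_Lambda2 f (m + d) =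
       (expR d + expR (- d)) * inv_Lambda2 f m.
  by apply: inv_Lambda2_shiftD => [//|y ymd|]; [apply: f0; lra|lra].
rewrite (hE (m - d) m) -?(hE m (m + d)); try lra.
move=> hm.
have /eqP : (expR d + expR (- d) - 2) * inv_Lambda2 f m = 0 by rewrite mulrBl -hm; ring.
by rewrite mulf_eq0 => /orP[|/eqP//]; rewrite gt_eqF// subr_gt0.
Qed.

Theorem theorem7p1 (R : realType) (omega T : R) (u : R -> R -> R)
  (T_gt0 : 0 < T)
  (u_sol : DGH_solution omega T u)
  (u_sign : (forall t x, 0 <= t < T -> 0 <= u t x) \/
            (forall t x, 0 <= t < T -> u t x <= 0))
  (u_conserved : conserved_integral T u)
  (nonlocal_C1 : forall t, 0 <= t < T -> C1 (nonlocal (u t)))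
  (u_vanishes : exists t0 t1 x0 x1 : R,
     [/\ 0 < t0, t0 < t1, t1 < T, x0 < x1 &
       forall t x, t0 < t < t1 -> x0 < x < x1 -> u t x = 0]) :
  forall t x, 0 <= t < T -> u t x = 0.
Proof.
have cu t : 0 <= t < T -> continuous (u t).
  by move=> tT; apply: derivable_continuous => x; exact: DGH_derivable_x u_sol _ _ tT.
have [t0 [t1 [x0 [x1 [t0_gt0 t01 t1T x01 u0]]]]] := u_vanishes.
(* Being interior to the time window, [s] sees [u] vanish at all nearby times, so the time
   derivative is zero there. *)
pose s := (t0 + t1) / 2.
have st : t0 < s < t1 by rewrite /s; lra.
have sT : 0 < s < T by lra.
have sT' : 0 <= s < T by lra.
have us0 : forall x, u s x = 0.
  have ux0 x : x0 < x < x1 -> derive1 (u s) x = 0.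
    by move=> xx; apply: derive1_locally_eq0 xx _ => y; exact: u0.
  have ut0 x : x0 < x < x1 -> derive1 (u ^~ x) s = 0.
    by move=> xx; apply: derive1_locally_eq0 st _ => t tt; exact: u0.
  have cf := DGH_convolvable u_sol sT'.
  have : inv_Lambda2 (flux (u s)) ((x0 + x1) / 2) = 0.
    apply: inv_Lambda2_locally_cst_eq0 => // x xx.
      by rewrite /flux u0// ux0// expr0n mul0r addr0.
    apply: DeriveDef; first exact: DGH_derivable_nonlocal u_sol _ _ sT'.
    rewrite -derive1E -/(nonlocal (u s) x).
    by apply/eqP; rewrite -oppr_eq0 -(DGH_equation u_sol)// ut0// ux0// mulr0 addr0.
  have flux0 y : 0 <= flux (u s) y by rewrite addr_ge0 ?divr_ge0 ?sqr_ge0.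
  move=> /(inv_Lambda2_eq0_ae _ _ _ cf flux0) f0.
  (* The flux is known to vanish only almost everywhere; its summand [u ^ 2] then does too, and
     continuity of [u s] gives every point. *)
  apply: continuous_ae_eq0; first exact: cu.
  apply: (@filterS _ _ (ae_filter_ringOfSetsType lebesgue_measure)) f0 => y /eqP.
  rewrite paddr_eq0 ?divr_ge0 ?sqr_ge0// sqrf_eq0.
  by move=> /andP[/eqP].
have [c Ic] := u_conserved.
(* The conserved value is read off at time [s]. *)
have c0 : c%:E = 0%E.
  rewrite -(Ic _ sT'); apply: integral0_eq => x _.
  by rewrite us0.
move=> t x tT; apply: continuous_integral_eq0; [exact: cu| |by rewrite Ic].
by case: u_sign => u_sign; [left|right] => y; exact: u_sign.
Qed.
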